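(* Let $q$ be a prime power, $M\ge1$ an integer, $h=(h_0,\dots,h_M)$ a probability vector, $\bar\eta\in(0,1)$, $\eta=1-\bar\eta$, and $D=\lceil M/\eta\rceil-1$. Let $\hat\theta$ be the optimal value of the optimization problem $$\max\ \theta\quad\text{s.t.}\quad \Omega(x;\Psi)+\theta\ln(1-x)\ge0\ \ (0\le x\le\bar\eta),\qquad \sum_{d=1}^D\Psi_d=1,\quad \Psi_d\ge0\ (d=1,\dots,D),$$ the maximum being over $\theta$ and $\Psi=(\Psi_1,\dots,\Psi_D)$. Then $$\hat\theta\ \ge\ \max_{r=1,2,\dots,M}\ r\sum_{i=r}^M\hbar_i .$$
   Context: For integers $m\ge r\ge 0$, $\zeta^m_r=\prod_{i=0}^{r-1}(1-q^{-m+i})$ (equal to $1$ if $r=0$). The effective rank distribution associated with $h$ is $\hbar_r=\sum_{i=r}^M\frac{\zeta^i_r}{q^{i-r}}h_i$, $r=1,\dots,M$. For positive integers $a,b$, $\mathrm{I}_{a,b}(x)=\sum_{j=a}^{a+b-1}\binom{a+b-1}{j}x^j(1-x)^{a+b-1-j}$ is the regularized incomplete beta function. Finally $$\Omega(x;\Psi)=\sum_{r=1}^M\hbar_r\sum_{d=r+1}^D d\Psi_d\,\mathrm{I}_{d-r,r}(x)+\sum_{r=1}^M r\Psi_r\sum_{s=r}^M\hbar_s,$$ with $\Psi_r=0$ for $r>D$ and empty sums equal to $0$. *)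

(* Defs.v *)
From HB Require Import structures.
From mathcomp Require Import all_boot all_order all_algebra.
From mathcomp Require Import all_classical all_reals all_analysis.

Set Implicit Arguments.
Unset Strict Implicit.
Unset Printing Implicit Defensive.

Import Order.TTheory GRing.Theory Num.Theory.

Local Open Scope classical_set_scope.
Local Open Scope ring_scope.

Definition prime_power (q : nat) : Prop :=
  exists p k : nat, [/\ prime p, (0 < k)%N & q = (p ^ k)%N].

Definition probability_vector (R : realType) (n : nat) (h : 'I_n -> R) : Prop :=
  (forall i, 0 <= h i) /\ \sum_i h i = 1.

(* Only meaningful for r <= m; then each exponent -m+i is -(m - i). *)
Definition zeta (R : realType) (q m r : nat) : R :=
  \prod_(i < r) (1 - q%:R ^- (m - i)).

Definition hbar (R : realType) (q M : nat) (h : 'I_M.+1 -> R) (r : nat) : R :=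
  \sum_(i < M.+1 | (r <= i)%N) zeta R q i r / q%:R ^+ (i - r) * h i.

(* Only meaningful for a, b >= 1. *)
Definition betaI (R : realType) (a b : nat) (x : R) : R :=
  \sum_(a <= j < a + b)
    'C((a + b).-1, j)%:R * x ^+ j * (1 - x) ^+ ((a + b).-1 - j).

(* Psi is indexed by nat; Psi 0 is never used, and Psi r for r > D is required
   to vanish in [feasible]. *)
Definition Omega (R : realType) (q M D : nat) (h : 'I_M.+1 -> R)
    (Psi : nat -> R) (x : R) : R :=
  \sum_(1 <= r < M.+1)
     hbar q h r * \sum_(r.+1 <= d < D.+1) d%:R * Psi d * betaI (d - r) r x
  + \sum_(1 <= r < M.+1) r%:R * Psi r * \sum_(r <= s < M.+1) hbar q h s.

Definition feasible (R : realType) (q M D : nat) (h : 'I_M.+1 -> R)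
    (etabar theta : R) (Psi : nat -> R) : Prop :=
  [/\ forall x : R, 0 <= x <= etabar ->
        0 <= Omega q D h Psi x + theta * ln (1 - x),
      \sum_(1 <= d < D.+1) Psi d = 1,
      forall d : nat, (1 <= d <= D)%N -> 0 <= Psi d &
      forall d : nat, (D < d)%N -> Psi d = 0].

(* The supremum is taken in the extended reals, so that no default value
   interferes when the problem is infeasible or unbounded. *)
Definition optimal_value (R : realType) (q M D : nat) (h : 'I_M.+1 -> R)
    (etabar : R) : \bar R :=
  ereal_sup [set theta%:E | theta in
    [set theta : R | exists Psi : nat -> R, feasible q D h etabar theta Psi]].

(* Main.v *)
Require Import Defs.
From HB Require Import structures.
From mathcomp Require Import all_boot all_order all_algebra.
From mathcomp Require Import all_classical all_reals all_analysis.
From mathcomp Require Import ring lra zify.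

(* Since I_{0,s} = 1, Omega is the sum over s of hbar_s times
   S_s(x) = sum_{d <= D} d Psi_d I_{d-s,s}(x), and S_s increases with s because
   I_{d-s,s}(x) is the probability that a Bin(d-1, 1-x) variable is below s.
   Hence it suffices to find, for each r, a Psi with S_r(x) + r ln(1-x) >= 0.
   For r < D take Psi_d = r / (d (d-1)) for r < d < D and Psi_D = r / (D-1), so
   that S_r / r = sum_{r < d <= D} I_{d-r,r} / (d-1) + I_{D-r,r}.  The infinite
   sum of the I_{d-r,r} / (d-1) is -ln(1-x); its tail beyond D is at most
   r x / (D (1-x)) I_{D-r,r}, which is proved by differentiating, and the choice
   of D makes that factor at most 1.  If r = D, then r = M = D, Psi is the unit
   mass at D, and 1 - x >= 1/2 suffices. *)

Import Order.TTheory GRing.Theory Num.Theory.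

Local Open Scope ring_scope.

(** * Nonnegativity from the sign of the derivative *)

Lemma ge0_of_deriv_ge0 {R : realType} (f df : R -> R) (b : R) :
  (forall x, 0 <= x <= b -> is_derive x 1 f (df x)) ->
  (forall x, 0 <= x <= b -> 0 <= df x) -> 0 <= f 0 ->
  forall x, 0 <= x <= b -> 0 <= f x.
Proof.
move=> fdf df0 f0 x /andP[x0 xb].
have sub y : y \in `[0, x] -> 0 <= y <= b.
  by rewrite in_itv/= => /andP[-> /le_trans->].
have [|y /sub yb fE] := @MVT_segment R f df 0 x x0 (fun y yx => fdf y (sub y (subset_itv_oo_cc yx))).
  apply: derivable_within_continuous => y /sub yb.
  exact: (@ex_derive _ _ _ _ _ _ _ (fdf _ yb)).
have -> : f x = f 0 + df y * (x - 0) by rewrite -fE addrC subrK.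
by rewrite addr_ge0// mulr_ge0 ?df0// subr0.
Qed.

(** * Bernstein polynomials *)

Definition bern {R : realType} (n k : nat) (x : R) : R :=
  'C(n, k)%:R * x ^+ k * (1 - x) ^+ (n - k).

Lemma bern_ge0 {R : realType} n k (x : R) : 0 <= x <= 1 -> 0 <= bern n k x.
Proof.
by case/andP=> x0 x1; rewrite !mulr_ge0 ?exprn_ge0 ?subr_ge0.
Qed.

Lemma bern_small {R : realType} n k (x : R) : (n < k)%N -> bern n k x = 0.
Proof. by move=> nk; rewrite /bern bin_small// !mul0r. Qed.

Lemma sum_bern {R : realType} n (x : R) : \sum_(k < n.+1) bern n k x = 1.
Proof.
have := exprDn (1 - x) x n; rewrite subrK expr1n => ->.
by apply: eq_bigr => k _; rewrite /bern -[RHS]mulr_natl mulrAC mulrA.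
Qed.

(** Pascal's rule, or conditioning on one of [n.+1] trials with success probability x. *)
Lemma bernS {R : realType} n k (x : R) :
  bern n.+1 k.+1 x = x * bern n k x + (1 - x) * bern n k.+1 x.
Proof.
have [kn|nk|->] := ltngtP k n.
- rewrite /bern binS natrD subSS -[(n - k)%N]prednK ?subn_gt0// -subnS !exprS.
  ring.
- by rewrite !bern_small ?mulr0 ?addr0// leqW.
- by rewrite (@bern_small _ n n.+1)// /bern !binn !subnn exprS; ring.
Qed.

Lemma is_derive_bern {R : realType} n k (x : R) :
  is_derive x 1 (bern n.+1 k.+1)
    (n.+1%:R * (bern n k x - bern n k.+1 x)).
Proof.
have dX m : is_derive x 1 (fun y : R => y ^+ m) (m%:R * x ^+ m.-1).
  have -> : (fun y : R => y ^+ m) = id ^+ m by apply/funext => y; rewrite exprfctE.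
  by apply: (is_derive_eq (is_deriveX m (is_derive_id x 1))); rewrite scaler1.
have dY m : is_derive x 1 (fun y : R => (1 - y) ^+ m)
    (- (m%:R * (1 - x) ^+ m.-1)).
  have d1 := is_deriveB (is_derive_cst (1 : R) x 1) (is_derive_id x (1 : R)).
  have -> : (fun y : R => (1 - y) ^+ m) = (cst 1 - id) ^+ m.
    by apply/funext => y; rewrite exprfctE.
  by apply: (is_derive_eq (is_deriveX m d1)); rewrite sub0r scalerN scaler1.
have := is_deriveM (is_deriveZ 'C(n.+1, k.+1)%:R (dX k.+1)) (dY (n.+1 - k.+1)%N).
move=> d; apply: (is_derive_eq d) => {d}.
(* The absorption identities for binomials turn both terms of the product rule into Bernstein
   polynomials of degree [n]. *)
have e1 : n.+1%:R * 'C(n, k)%:R = k.+1%:R * 'C(n.+1, k.+1)%:R :> R.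
  by rewrite -!natrM mul_bin_diag.
have e2 : n.+1%:R * 'C(n, k.+1)%:R = (n - k)%:R * 'C(n.+1, k.+1)%:R :> R.
  by rewrite -!natrM mul_bin_down subSS.
rewrite /bern mulrBr !mulrA e1 e2 /= subSS subnS.
rewrite /GRing.scale/=; ring.
Qed.

(** * The incomplete beta function at integer parameters *)

Lemma betaIE {R : realType} a b (x : R) :
  betaI a b.+1 x = \sum_(a <= j < (a + b).+1) bern (a + b) j x.
Proof. by rewrite /betaI addnS. Qed.

Lemma betaI_ge0 {R : realType} a b (x : R) : 0 <= x <= 1 -> 0 <= betaI a b.+1 x.
Proof. by move=> x01; rewrite betaIE; apply: sumr_ge0 => j _; exact: bern_ge0. Qed.

Lemma betaI0n {R : realType} b (x : R) : betaI 0 b.+1 x = 1.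
Proof. by rewrite betaIE big_mkord sum_bern. Qed.

Lemma betaI_at0 {R : realType} a b : betaI a.+1 b.+1 (0 : R) = 0.
Proof.
by rewrite betaIE big_nat big1// => -[|j]// _; rewrite /bern expr0n mulr0 mul0r.
Qed.

(** The derivatives of the Bernstein terms telescope; what remains is the density of the beta
    distribution with parameters a+1 and b+1. *)
Lemma is_derive_betaI {R : realType} a b (x : R) :
  is_derive x 1 (betaI a.+1 b.+1) ((a + b).+1%:R * bern (a + b) a x).
Proof.
have -> : betaI a.+1 b.+1 = \sum_(i < b.+1) (bern (a + b).+1 (a + i).+1 : R -> R).
  apply/funext => y; rewrite betaIE fct_sumE !addSn.
  rewrite -{1}[a.+1]add0n big_addn -subSS.
have -> : ((a + b).+3 - a.+2 = b.+1)%N by lia.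
rewrite big_mkord; apply: eq_bigr => i _.
  by rewrite addnS [(i + a)%N]addnC.
have := is_derive_sum (fun i : 'I_b.+1 => is_derive_bern (a + b) (a + i) x).
move=> d; apply: (is_derive_eq d) => {d}.
rewrite -mulr_sumr; congr *%R.
rewrite -(big_mkord xpredT (fun i => bern (a + b) (a + i) x - bern (a + b) (a + i).+1 x)).
under eq_bigr do rewrite -opprB -addnS.
rewrite sumrN (telescope_sumr (fun i => bern (a + b) (a + i) x))//.
by rewrite addn0 bern_small ?sub0r ?opprK// ltn_add2l.
Qed.

(** In trials with success probability x, [betaI a b.+1 x] is the probability of at least [a]
    successes before failure number [b.+1]; the subtracted term is the probability of exactly
    [a]. *)
Lemma betaIS {R : realType} a b (x : R) :
  betaI a.+1 b.+1 x = betaI a b.+1 x - (1 - x) * bern (a + b) a x.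
Proof.
rewrite !betaIE big_add1/= addSn.
have bernS' j : bern (a + b).+1 j.+1 x =
    bern (a + b) j x + (1 - x) * (bern (a + b) j.+1 x - bern (a + b) j x).
  by rewrite bernS; ring.
under eq_bigr do rewrite bernS'.
rewrite big_split/= -mulr_sumr (telescope_sumr (fun j => bern (a + b) j x)).
  by rewrite (@bern_small _ (a + b) (a + b).+1)// sub0r mulrN.
by rewrite leqW ?leq_addr.
Qed.

Lemma betaI_compl {R : realType} a b (x : R) :
  betaI a b.+1 x = 1 - (1 - x) * \sum_(j < a) bern (j + b) j x.
Proof.
elim: a => [|a IH]; first by rewrite betaI0n big_ord0 mulr0 subr0.
by rewrite betaIS IH big_ord_recr/=; ring.
Qed.

Lemma mul_bern_diag {R : realType} n k (x : R) :
  k.+1%:R * bern n.+1 k.+1 x = n.+1%:R * x * bern n k x.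
Proof.
have e : n.+1%:R * 'C(n, k)%:R = k.+1%:R * 'C(n.+1, k.+1)%:R :> R.
  by rewrite -!natrM mul_bin_diag.
by rewrite /bern !mulrA -e subSS exprS; ring.
Qed.

Lemma mul_bern_down {R : realType} n k (x : R) : (k <= n)%N ->
  (n.+1 - k)%:R * bern n.+1 k x = n.+1%:R * (1 - x) * bern n k x.
Proof.
move=> kn.
have e : n.+1%:R * 'C(n, k)%:R = (n.+1 - k)%:R * 'C(n.+1, k)%:R :> R.
  by rewrite -!natrM mul_bin_down.
by rewrite /bern !mulrA -e subSn// exprS; ring.
Qed.

(** Let w be the derivative of I = [betaI a.+1 b.+1]. Then (x(1-x)w)' = (a+1-(a+b+2)x)w, so the
    difference of the two sides vanishes at 0 and has derivative (a+b+2)I >= 0. *)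
Lemma betaI_le_deriv {R : realType} a b (x : R) : 0 <= x <= 1 ->
  (a.+1%:R - (a + b).+2%:R * x) * betaI a.+1 b.+1 x
    <= x * (1 - x) * ((a + b).+1%:R * bern (a + b) a x).
Proof.
move=> x01; rewrite -subr_ge0.
(* As a multiple of one Bernstein polynomial, y(1-y)w can be differentiated by [is_derive_bern]. *)
have diagE (y : R) : y * (1 - y) * ((a + b).+1%:R * bern (a + b) a y) =
    a.+1%:R * b.+1%:R / (a + b).+2%:R * bern (a + b).+2 a.+1 y.
  apply: (mulfI (_ : (a + b).+2%:R != 0 :> R)); first by rewrite pnatr_eq0.
  have := @mul_bern_diag R (a + b).+1 a y.
  have := @mul_bern_down R (a + b) a y (leq_addr _ _).
  rewrite subSn ?leq_addr// addKn => e2 e1.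
  transitivity ((a + b).+2%:R * y * (b.+1%:R * bern (a + b).+1 a y)).
    by rewrite e2; ring.
  transitivity (b.+1%:R * (a.+1%:R * bern (a + b).+2 a.+1 y)).
    by rewrite e1; ring.
  by field; rewrite -!natrD pnatr_eq0.
pose f (y : R) := a.+1%:R * b.+1%:R / (a + b).+2%:R * bern (a + b).+2 a.+1 y
  - (a.+1%:R - (a + b).+2%:R * y) * betaI a.+1 b.+1 y.
pose df (y : R) := (a + b).+2%:R * betaI a.+1 b.+1 y.
rewrite diagE.
apply: (@ge0_of_deriv_ge0 R f df 1) => //.
- move=> y _.
  have d1 := is_deriveZ (a.+1%:R * b.+1%:R / (a + b).+2%:R)
               (is_derive_bern (a + b).+1 a y).
  have d2 : is_derive y 1 (fun z : R => a.+1%:R - (a + b).+2%:R * z)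
      (- (a + b).+2%:R).
    apply: (is_derive_eq (is_deriveB (is_derive_cst (a.+1%:R : R) y 1)
      (is_deriveZ (a + b).+2%:R (is_derive_id y (1 : R))))).
    by rewrite /GRing.scale/= mulr1 sub0r.
  have := is_deriveB d1 (is_deriveM d2 (is_derive_betaI a b y)).
  move=> d; apply: (is_derive_eq d) => {d d1 d2}.
  rewrite /df /GRing.scale/=.
  have := @mul_bern_diag R (a + b) a y.
  have := @mul_bern_down R (a + b) a y (leq_addr _ _).
  rewrite subSn ?leq_addr// addKn => e2 e1.
  have n0 : (a + b).+2%:R != 0 :> R by rewrite pnatr_eq0.
  rewrite mulrA divfK//.
  transitivity (a.+1%:R * (b.+1%:R * bern (a + b).+1 a y)
    - b.+1%:R * (a.+1%:R * bern (a + b).+1 a.+1 y)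
    - ((a.+1%:R - (a + b).+2%:R * y) * ((a + b).+1%:R * bern (a + b) a y)
       - betaI a.+1 b.+1 y * (a + b).+2%:R)).
    ring.
  by rewrite e1 e2; ring.
- by move=> y y01; rewrite mulr_ge0// betaI_ge0.
- by rewrite /f betaI_at0 /bern expr0n !(mulr0, mul0r) subr0.
Qed.

(** * The logarithmic series and its tail *)

(** The weights cancel the normalising factors of the densities. By [betaI_compl] the resulting sum
    is (1 - I_{a,b+1}(x)) / (1-x), to be compared with 1/(1-x), the derivative of -ln(1-x). *)
Lemma is_derive_sum_betaI {R : realType} a b (x : R) :
  is_derive x 1 (fun y => \sum_(j < a) betaI j.+1 b.+1 y / (j + b).+1%:R)
    (\sum_(j < a) bern (j + b) j x).
Proof.
have := is_derive_sum (fun j : 'I_a => is_deriveZ (j + b).+1%:R^-1 (is_derive_betaI j b x)).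
move=> d.
have -> : (fun y : R => \sum_(j < a) betaI j.+1 b.+1 y / (j + b).+1%:R) =
   \sum_(j < a) ((j + b).+1%:R^-1 \*: (betaI j.+1 b.+1 : R -> R)).
  by apply/funext => y; rewrite fct_sumE; apply: eq_bigr => j _; rewrite mulrC.
apply: (is_derive_eq d); apply: eq_bigr => j _.
by rewrite /GRing.scale/= mulKf// pnatr_eq0.
Qed.

(* The last term bounds the tail of the series
   -ln(1-x) = sum_j I_{j+1,b+1}(x) / (j+b+1) after its first a+1 terms. *)
Lemma ln1B_ge_betaI {R : realType} a b (x : R) : 0 <= x < 1 ->
  0 <= \sum_(j < a.+1) betaI j.+1 b.+1 x / (j + b).+1%:R + ln (1 - x)
       + b.+1%:R / (a + b).+2%:R * ((1 - x)^-1 - 1) * betaI a.+1 b.+1 x.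
Proof.
move=> /andP[x0 x1].
pose f (y : R) := \sum_(j < a.+1) betaI j.+1 b.+1 y / (j + b).+1%:R + ln (1 - y)
       + b.+1%:R / (a + b).+2%:R * ((1 - y)^-1 - 1) * betaI a.+1 b.+1 y.
pose c : R := b.+1%:R / (a + b).+2%:R.
pose df (y : R) := \sum_(j < a.+1) bern (j + b) j y - (1 - y)^-1
   + (c * ((1 - y) ^- 2) * betaI a.+1 b.+1 y
     + c * ((1 - y)^-1 - 1) * ((a + b).+1%:R * bern (a + b) a y)).
apply: (@ge0_of_deriv_ge0 R f df x); last by rewrite x0 lexx.
- move=> y /andP[y0 yx].
  have y1 : 0 < 1 - y by rewrite subr_gt0 (le_lt_trans yx).
  have d1 : is_derive y 1 (fun z : R => 1 - z) (- 1).
    apply: (is_derive_eq (is_deriveB (is_derive_cst (1 : R) y 1)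
      (is_derive_id y (1 : R)))).
    by rewrite sub0r.
  have d2 := @is_derive1_comp R (@ln R) (fun z => 1 - z) y _ _
    (@is_derive1_ln R (1 - y) y1) d1.
  have d3 : is_derive y 1 (fun z : R => (1 - z)^-1) ((1 - y) ^- 2).
    apply: (is_derive_eq (@is_deriveV R (fun z => 1 - z) y _ _ (lt0r_neq0 y1) d1)).
    by rewrite /GRing.scale/= mulrNN mulr1.
  have d4 : is_derive y 1 (fun z : R => c * ((1 - z)^-1 - 1)) (c * (1 - y) ^- 2).
    apply: (is_derive_eq (is_deriveZ c (is_deriveB d3 (is_derive_cst (1 : R) y 1)))).
    by rewrite subr0.
  have := is_deriveD (is_deriveD (is_derive_sum_betaI a.+1 b y) d2)
            (is_deriveM d4 (is_derive_betaI a b y)).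
  move=> d; apply: (is_derive_eq d); rewrite /df /GRing.scale/=.
  ring.
- move=> y /andP[y0 yx].
  have y1 : 0 < 1 - y by rewrite subr_gt0 (le_lt_trans yx).
  have y01 : 0 <= y <= 1 by rewrite y0 ltW// -subr_gt0.
  have n0 : 0 < (a + b).+2%:R :> R by rewrite ltr0n.
  have L0 : 0 <= y * (1 - y) * ((a + b).+1%:R * bern (a + b) a y).
    by apply: mulr_ge0; apply: mulr_ge0 => //; [exact: ltW | exact: bern_ge0].
  have bL : y * (1 - y) * ((a + b).+1%:R * bern (a + b) a y) <=
      b.+1%:R * (y * (1 - y) * ((a + b).+1%:R * bern (a + b) a y)).
    by rewrite ler_peMl// ler1n.
  have IL := le_trans (betaI_le_deriv a b y y01) bL.
  have sE : \sum_(j < a.+1) bern (j + b) j y = (1 - betaI a.+1 b.+1 y) / (1 - y).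
    by rewrite betaI_compl opprB addrC subrK mulrC mulKf// gt_eqF.
  (* The 1/(1-y) of the logarithm cancels against [sE]. The numerator left over is the inequality of
     [betaI_le_deriv], its right side enlarged by the factor b+1 >= 1. *)
  have -> : df y = (b.+1%:R * (y * (1 - y) * ((a + b).+1%:R * bern (a + b) a y))
      - (a.+1%:R - (a + b).+2%:R * y) * betaI a.+1 b.+1 y)
      / ((a + b).+2%:R * (1 - y) ^+ 2).
    rewrite /df sE /c; field.
    by rewrite -!natrD !pnatr_eq0 gt_eqF.
  by rewrite divr_ge0 ?subr_ge0// mulr_ge0 ?exprn_ge0// ltW.
- rewrite /f subr0 invr1 subrr !(mulr0, mul0r) addr0 ln1 addr0.
  by rewrite big1// => j _; rewrite betaI_at0 mul0r.
Qed.

(** * Reduction of the constraint on Omega to a single index r *)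

(** As long as s < d, these are upper tails of one binomial law with d-1 trials, and raising s
    lowers the threshold. *)
Lemma betaI_shift_le {R : realType} d (x : R) : 0 <= x <= 1 ->
  {homo (fun s => betaI (d - s.+1) s.+1 x) : s t / (s <= t)%N >-> s <= t}.
Proof.
move=> x01; apply: homo_leq => [//|u v w|s]; first exact: le_trans.
(* For d <= s+1 truncated subtraction makes both first parameters 0, and both values are 1. *)
have [ds|sd] := leqP d s.+1.
  have -> : (d - s.+1 = 0)%N by lia.
  by have -> : (d - s.+2 = 0)%N; [lia | rewrite !betaI0n].
have -> : (d - s.+1 = (d - s.+2).+1)%N by lia.
rewrite !betaIE addSnnS [leRHS]big_ltn ?lerDr ?bern_ge0//.
by rewrite ltnS leq_addr.
Qed.

Lemma hbar_ge0 {R : realType} q M (h : 'I_M.+1 -> R) r :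
  (0 < q)%N -> (forall i, 0 <= h i) -> 0 <= hbar q h r.
Proof.
move=> q0 h0; apply: sumr_ge0 => i _; rewrite mulr_ge0// divr_ge0 ?exprn_ge0//.
apply: prodr_ge0 => j _; rewrite subr_ge0 invf_le1 ?exprn_gt0 ?ltr0n//.
by rewrite exprn_ege1// ler1n.
Qed.

(** Exchanging the second double sum gives, for each s, the terms with d <= s: there [d - s]
    truncates to 0 and the beta factor is 1. [M <= D] keeps these d in range. *)
Lemma OmegaE {R : realType} q M D (h : 'I_M.+1 -> R) Psi (x : R) :
  (M <= D)%N ->
  Omega q D h Psi x = \sum_(1 <= s < M.+1)
    hbar q h s * \sum_(1 <= d < D.+1) d%:R * Psi d * betaI (d - s) s x.
Proof.
move=> MD; rewrite /Omega.
have -> : \sum_(1 <= r < M.+1) r%:R * Psi r * \sum_(r <= s < M.+1) hbar q h s =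
    \sum_(1 <= s < M.+1) hbar q h s * \sum_(1 <= d < s.+1) d%:R * Psi d.
  transitivity (\sum_(1 <= r < M.+1) \sum_(1 <= s < M.+1 | (r <= s)%N)
      hbar q h s * (r%:R * Psi r)).
    apply: eq_big_nat => r /andP[r1 _]; rewrite (@big_nat_widenl _ _ _ r 1)//.
    by rewrite mulr_sumr; apply: eq_bigr => s _; rewrite mulrC.
  rewrite (@exchange_big_dep_nat _ _ _ _ _ _ _ _ _ xpredT)//=.
  apply: eq_big_nat => s /andP[s1 sM].
  by rewrite mulr_sumr [RHS](@big_nat_widen _ _ _ 1 s.+1 M.+1).
rewrite -big_split/=; apply: eq_big_nat => s /andP[s1 sM].
rewrite -mulrDr; congr *%R; rewrite addrC [RHS](@big_cat_nat _ _ _ s.+1)//=; last first.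
  by rewrite ltnS (leq_trans _ MD).
congr (_ + _); apply: eq_big_nat => d /andP[d1 ds].
have -> : (d - s = 0)%N by lia.
by rewrite -[s]prednK// betaI0n mulr1.
Qed.

(** The terms with s < r are nonnegative and dropped; for s >= r, [betaI_shift_le] lets r replace s
    in the inner sum. *)
Lemma Omega_ge {R : realType} q M D (h : 'I_M.+1 -> R) Psi (x : R) r :
  (0 < q)%N -> (forall i, 0 <= h i) -> (0 < r <= M)%N -> (M <= D)%N ->
  (forall d : nat, (1 <= d <= D)%N -> 0 <= Psi d) -> 0 <= x <= 1 ->
  (\sum_(r <= s < M.+1) hbar q h s) *
    \sum_(1 <= d < D.+1) d%:R * Psi d * betaI (d - r) r x
  <= Omega q D h Psi x.
Proof.
move=> q0 h0 /andP[r0 rM] MD Psi0 x01.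
have W0 d : (0 < d < D.+1)%N -> 0 <= d%:R * Psi d.
  by move=> dD; rewrite mulr_ge0// Psi0.
rewrite OmegaE// [leRHS](@big_cat_nat _ _ _ r)//=; last by rewrite leqW.
rewrite mulr_suml -[leLHS]add0r lerD//.
  rewrite big_nat; apply: sumr_ge0 => s /andP[s0 _].
  rewrite mulr_ge0 ?hbar_ge0// big_nat; apply: sumr_ge0 => d dD.
  by rewrite mulr_ge0 ?W0// -[s]prednK// betaI_ge0.
apply: ler_sum_nat => s /andP[rs _]; rewrite ler_wpM2l ?hbar_ge0//.
apply: ler_sum_nat => d dD; rewrite ler_wpM2l ?W0//.
have s0 := leq_trans r0 rs.
rewrite -[r]prednK// -[s]prednK//; apply: betaI_shift_le => //.
by rewrite -ltnS !prednK.
Qed.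

(** The inequality for r, multiplied by the nonnegative tail sum of [hbar], is added to
    [Omega_ge]. *)
Lemma feasible_of_le {R : realType} q M D (h : 'I_M.+1 -> R) (etabar : R) Psi r :
  (0 < q)%N -> (forall i, 0 <= h i) -> (0 < r <= M)%N -> (M <= D)%N ->
  etabar <= 1 ->
  (forall x, 0 <= x <= etabar ->
    0 <= \sum_(1 <= d < D.+1) d%:R * Psi d * betaI (d - r) r x
         + r%:R * ln (1 - x)) ->
  \sum_(1 <= d < D.+1) Psi d = 1 ->
  (forall d : nat, (1 <= d <= D)%N -> 0 <= Psi d) ->
  (forall d : nat, (D < d)%N -> Psi d = 0) ->
  feasible q D h etabar (r%:R * \sum_(r <= i < M.+1) hbar q h i) Psi.
Proof.
move=> q0 h0 rM MD e1 WP sP P0 PD; split=> // x xe.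
have x01 : 0 <= x <= 1 by case/andP: xe => -> /le_trans->.
have := Omega_ge q M D h Psi x r q0 h0 rM MD P0 x01.
rewrite -subr_ge0 => O0.
have := mulr_ge0 (_ : 0 <= \sum_(r <= i < M.+1) hbar q h i) (WP x xe).
rewrite sumr_ge0 => [/(_ isT)|s _]; last exact: hbar_ge0.
move=> /(addr_ge0 O0) /le_trans; apply; rewrite le_eqVlt; apply/orP; left.
by apply/eqP; ring.
Qed.

(** * The distribution used for r < D *)

(* At d = D the value simplifies to r / (D - 1); this form keeps d Psi_d simple. *)
Definition truncated_soliton {R : realType} (r D d : nat) : R :=
  if (r < d <= D)%N then (r%:R / d.-1%:R + (d == D)%:R * r%:R) / d%:R else 0.

(** Since r/(d(d-1)) = r/(d-1) - r/d, the regular part telescopes to 1 - r/D; the extra term at d =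
    D supplies r/D. *)
Lemma sum_truncated_soliton {R : realType} r D : (0 < r < D)%N ->
  \sum_(1 <= d < D.+1) truncated_soliton r D d = 1 :> R.
Proof.
move=> /andP[r0 rD]; rewrite (@big_cat_nat _ _ _ r.+1)//=; last by rewrite ltnS ltnW.
rewrite big_nat big1 ?add0r => [|d /andP[_]]; last first.
  by rewrite ltnS /truncated_soliton => dr; rewrite ltnNge dr.
have D0 : D%:R != 0 :> R by rewrite pnatr_eq0; lia.
have -> : \sum_(r.+1 <= d < D.+1) truncated_soliton r D d =
    \sum_(r.+1 <= d < D.+1)
      ((- (r%:R / d%:R) - - (r%:R / d.-1%:R)) + (d == D)%:R * r%:R / d%:R) :> R.
  apply: eq_big_nat => d dD; rewrite /truncated_soliton dD.
  have d0 : d%:R != 0 :> R by rewrite pnatr_eq0; lia.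
  have dE : d%:R = d.-1%:R + 1 :> R by rewrite -[in LHS](@prednK d) ?mulrSr//; lia.
  have d10 : d.-1%:R != 0 :> R by rewrite pnatr_eq0; lia.
  rewrite dE in d0 *; field; rewrite d0 d10//.
rewrite big_split/= big_add1/= (telescope_sumr (fun d => - (r%:R / d%:R))) 1?ltnW//.
rewrite big_nat_recr//= eqxx big_nat big1 ?add0r => [|d /andP[_ dD]]; last first.
  by rewrite ltn_eqF// !mul0r.
have r10 : r%:R != 0 :> R by rewrite pnatr_eq0; lia.
by rewrite mul1r; field; rewrite r10 D0.
Qed.

(** The extra mass at D contributes r I_{D-r,r}(x), which pays for the tail term of
    [ln1B_ge_betaI]. *)
Lemma truncated_soliton_bound {R : realType} r D (x : R) : (0 < r < D)%N ->
  0 <= x < 1 -> r%:R <= D.+1%:R * (1 - x) ->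
  0 <= \sum_(1 <= d < D.+1) d%:R * truncated_soliton r D d * betaI (d - r) r x
         + r%:R * ln (1 - x).
Proof.
(* With r = b+1, D = a+b+2 and d = j+b+2 one has d-r = j+1 and d-1 = j+b+1, matching
   [ln1B_ge_betaI]. *)
case: r => // b /= bD x01 xD; have [a Da] : exists a, D = (a + b).+2.
  by exists (D - b.+2)%N; lia.
rewrite {}Da in bD xD *.
have x01' : 0 <= x <= 1 by case/andP: x01 => -> /ltW.
have y0 : 0 < 1 - x by rewrite subr_gt0; case/andP: x01.
have -> : \sum_(1 <= d < (a + b).+3)
    d%:R * truncated_soliton b.+1 (a + b).+2 d * betaI (d - b.+1) b.+1 x =
   b.+1%:R * (\sum_(j < a.+1) betaI j.+1 b.+1 x / (j + b).+1%:R + betaI a.+1 b.+1 x).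
  rewrite (@big_cat_nat _ _ _ b.+2)//=; last by lia.
  rewrite big_nat big1 ?add0r => [|d /andP[_]]; last first.
    by rewrite ltnS /truncated_soliton => dr; rewrite ltnNge dr/= mulr0 mul0r.
  have -> : (a + b).+3 = (a.+1 + b.+2)%N by lia.
  rewrite -{1}[b.+2]add0n big_addn addnK.
  transitivity (\sum_(0 <= i < a.+1)
    (b.+1%:R * (betaI i.+1 b.+1 x / (i + b).+1%:R)
     + (i == a)%:R * (b.+1%:R * betaI i.+1 b.+1 x))).
    apply: eq_big_nat => i ia; rewrite /truncated_soliton.
    have -> : (b.+1 < i + b.+2 <= (a + b).+2)%N by lia.
    have -> : (i + b.+2 - b.+1 = i.+1)%N by lia.
    have -> : (i + b.+2 == (a + b).+2)%N = (i == a) by lia.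
    rewrite mulrCA divff ?mulr1; last by rewrite pnatr_eq0; lia.
    by rewrite !addnS/=; ring.
  rewrite big_split/= -mulr_sumr mulrDr !big_mkord; congr +%R.
  rewrite big_ord_recr/= eqxx mul1r big1 ?add0r// => i _.
  by rewrite ltn_eqF// mul0r.
rewrite -mulrDr mulr_ge0//.
have S0 := @ln1B_ge_betaI R a b x x01.
suff cI : b.+1%:R / (a + b).+2%:R * ((1 - x)^-1 - 1) * betaI a.+1 b.+1 x
    <= betaI a.+1 b.+1 x.
  by rewrite (le_trans S0)// -addrA [leRHS]addrAC -[leRHS]addrA lerD2l lerD2l.
rewrite ler_piMl ?betaI_ge0//.
(* The coefficient is at most 1 iff b+1 <= (a+2b+3)(1-x); the hypothesis gives this already with D+1
   = a+b+3 in place of a+2b+3. *)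
rewrite mulrAC ler_pdivrMr ?ltr0n// mul1r mulrBr mulr1 lerBlDr.
rewrite ler_pdivrMr// (le_trans xD)//; apply: ler_wpM2r; first exact: ltW.
by rewrite -natrD ler_nat; lia.
Qed.

(** * The choice of D and the optimal value *)

(** [D.+1] is the ceiling of M/eta, and M/eta > M because eta < 1. *)
Lemma ceil_bounds {R : realType} (M D : nat) (eta : R) :
  (0 < M)%N -> 0 < eta < 1 -> D%:Z = Num.ceil (M%:R / eta) - 1 ->
  (M <= D)%N /\ M%:R <= D.+1%:R * eta.
Proof.
move=> M0 /andP[eta0 eta1] hD.
have D1 : D.+1%:Z = Num.ceil (M%:R / eta) by rewrite intS hD addrC subrK.
split; last first.
  by rewrite -ler_pdivrMr// (le_trans (ceil_ge _))// -D1.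
rewrite -ltnS -ltz_nat D1 ceil_gt_int ltr_pdivlMr//.
by rewrite gtr_pMr// ltr0n.
Qed.

Lemma le_optimal_value {R : realType} q M D (h : 'I_M.+1 -> R) (etabar : R) r :
  (0 < q)%N -> (forall i, 0 <= h i) -> (0 < r <= M)%N ->
  0 < etabar < 1 -> D%:Z = Num.ceil (M%:R / (1 - etabar)) - 1 ->
  ((r%:R * \sum_(r <= i < M.+1) hbar q h i)%:E <= optimal_value q D h etabar)%E.
Proof.
move=> q0 h0 rM /andP[e0 e1] hD.
have M0 : (0 < M)%N by lia.
have [|MD Meta] := ceil_bounds M D (1 - etabar) M0 _ hD.
  by rewrite subr_gt0 e1 gtrBl.
have xM (x : R) : 0 <= x <= etabar -> 0 <= x < 1 /\ M%:R <= D.+1%:R * (1 - x).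
  case/andP=> x0 xe; split; first by rewrite x0 (le_lt_trans xe).
  by rewrite (le_trans Meta)// ler_wpM2l// lerB.
have rD : (r <= D)%N by lia.
apply: ereal_sup_ubound; eexists; last by [].
have [rltD|Dr] := ltnP r D.
  exists (truncated_soliton r D); apply: feasible_of_le => //.
  - exact: ltW.
  - move=> x /xM[x01 Mx]; apply: truncated_soliton_bound => //; first by lia.
    by rewrite (le_trans _ Mx)// ler_nat; lia.
  - by apply: sum_truncated_soliton; lia.
  - by move=> d _; rewrite /truncated_soliton; case: ifP.
  - by move=> d Dd; rewrite /truncated_soliton [(d <= D)%N]leqNgt Dd andbF.
(* From D <= r <= M <= D all three agree. *)
have rE : r = D by lia.
have ME : M = D by lia.
have D0 : (0 < D)%N by lia.
exists (fun d => (d == D)%:R); apply: feasible_of_le => //.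
- exact: ltW.
- move=> x /xM[x01 Mx].
  (* Now D <= (D+1)(1-x), so 1-x >= D/(D+1) >= 1/2. *)
  have y12 : 1 / 2 <= 1 - x.
    rewrite ME in Mx M0; rewrite ler_pdivrMr//.
    rewrite -(@ler_pM2l _ D%:R) ?ltr0n//.
    have D1 : 1 <= D%:R :> R by rewrite ler1n.
    rewrite mulrS in Mx.
    nra.
  rewrite big_nat_recr//= eqxx big_nat big1 ?add0r => [|d /andP[_ dD]]; last first.
    by rewrite ltn_eqF// mulr0 mul0r.
  have I1 : betaI 0 D x = 1 by rewrite -[D]prednK// betaI0n.
  rewrite rE subnn I1 !mulr1 -[X in X + _]mulr1 -mulrDr.
  have y0 : 0 < 1 - x by rewrite (lt_le_trans _ y12).
  have yV : (1 - x)^-1 <= 2 by rewrite invf_ple ?posrE// -div1r.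
  (* This is ln(1+t) <= t at t = 1/(1-x) - 1. As t <= 1, it yields 1 + ln(1-x) >= 0. *)
  have lnx : - ln (1 - x) <= (1 - x)^-1 - 1.
    rewrite -lnV// -[X in ln X](subrK 1) [X in ln X]addrC le_ln1Dx//.
    by rewrite ltrBrDr addNr invr_gt0.
  by rewrite mulr_ge0//; lra.
- rewrite big_nat_recr//= eqxx.
  by rewrite big_nat big1 ?add0r// => d /andP[_ dD]; rewrite ltn_eqF.
- by move=> d Dd; rewrite gtn_eqF.
Qed.

Theorem theorem5 (R : realType) (q M D : nat) (h : 'I_M.+1 -> R)
    (etabar eta : R)
    (hq : prime_power q) (hM : (1 <= M)%N) (hh : probability_vector h)
    (hetabar : 0 < etabar < 1) (heta : eta = 1 - etabar)
    (hD : D%:Z = Num.ceil (M%:R / eta) - 1) :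
  (\big[maxe/-oo]_(1 <= r < M.+1)
     (r%:R * \sum_(r <= i < M.+1) hbar q h i)%:E
   <= optimal_value q D h etabar)%E.
Proof.
have q0 : (0 < q)%N.
  by case: hq => p [k [p_prime _ ->]]; rewrite expn_gt0 prime_gt0.
rewrite big_nat; apply: bigmax_le => [|r rM]; first exact: leNye.
by apply: le_optimal_value => //; [case: hh | rewrite -heta].
Qed.
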